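(* Let $n\ge3$, $\mathcal C,\mathcal P\in\mathbb R^n$ and $\mathcal A\in\Lambda^2\mathbb R^n$, and for $u\in\overline{\mathcal S}(\mathbb R^n)$ put $F(u)=\langle\mathcal C,X(u)\rangle+\langle\mathcal P,Y(u)\rangle+\langle\mathcal A,\omega(u)\rangle$. Suppose one of the following holds: (1) $\mathcal A=0$; (2) $\mathcal A$ is a simple two-form and $\mathcal C=0$; (3) $\mathcal A$ is a simple two-form and $\mathcal P=0$. Then the minimum of $F$ over $\{u:|u|=1\}$ is attained at some $u$ with $N(u)=|X(u)|=|Y(u)|=1$.
   Context: $\overline{\mathcal S}(\mathbb R^n)=\mathcal S\oplus\mathcal S$, where $\mathcal S$ is the complex spinor module of $\mathbb R^n$ with Hermitian inner product $\langle\cdot,\cdot\rangle$ (complex linear in the first slot) on which vectors act skew-Hermitian with $vw+wv=-2\langle v,w\rangle$; $\overline{\mathcal S}$ has direct-sum inner product, and a vector $e_l$ and an extra element $e_0$ act by $e_l(\psi_1,\psi_2)=(e_l\psi_1,-e_l\psi_2)$, $e_0(\psi_1,\psi_2)=(\psi_2,\psi_1)$. For the standard basis $\{e_i\}$ with summation: $N(u)=|u|^2$, $X(u)=\langle e_ie_0u,u\rangle e_i$, $Y(u)=\langle\mathbf ie_iu,u\rangle e_i$, $\omega_{ij}(u)=\operatorname{Im}\langle e_ie_je_0u,u\rangle$. The pairing of two-forms is $\langle\mathcal A,\omega\rangle=\sum_{i<j}\mathcal A_{ij}\omega_{ij}$. A two-form $\mathcal A$ is simple if $\mathcal A=a\,e_1'\wedge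 e_2'$ for some $a\in\mathbb R$ and some orthonormal $e_1',e_2'$. *)

(* Defs.v *)
From HB Require Import structures.
From mathcomp Require Import all_boot all_order all_algebra.
From mathcomp Require Import complex.
Set Implicit Arguments. Unset Strict Implicit. Unset Printing Implicit Defensive.
Import Order.TTheory GRing.Theory Num.Theory.
Local Open Scope ring_scope.
Local Open Scope complex_scope.

Section Spinors.
Variable R : rcfType.
Local Notation C := (R[i]).

(* The complex spinor module S of R^n, n = 2m or 2m+1 (m = n./2):         *)
(* S = C^(2^m), realised as functions on bit strings s : 'I_m -> bool     *)
(* (fermionic Fock space); the Clifford generators e_0..e_(n-1) are given *)
(* by the Jordan-Wigner construction (times i, so that they are           *)
(* skew-Hermitian and square to -1); for n odd the last generator is      *)
(* i times the chirality (product of all Z's).                            *)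

Definition bits (m : nat) := {ffun 'I_m -> bool}.
Definition spinor (m : nat) := bits m -> C.

Definition flip m (j : nat) (s : bits m) : bits m :=
  [ffun k => if nat_of_ord k == j then ~~ s k else s k].
Definition par m (j : nat) (s : bits m) : nat :=
  #|[pred k : 'I_m | (nat_of_ord k < j)%N && s k]|.
Definition sgn (b : nat) : C := (-1) ^+ b.
Definition bitj m (j : nat) (s : bits m) : bool :=
  [exists k : 'I_m, (nat_of_ord k == j) && s k].

Definition gam (n : nat) (k : nat) (psi : spinor n./2) : spinor n./2 :=
  fun s =>
    if (k < (n./2).*2)%N then
      let j := k./2 in
      if ~~ odd k then 'i * sgn (par j s) * psi (flip j s)
      else 'i * sgn (par j s) * (if bitj j s then 'i else - 'i) * psi (flip j s)
    else 'i * sgn (par n./2 s) * psi s.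

Definition sdot m (phi psi : spinor m) : C :=
  \sum_(s : bits m) phi s * conjc (psi s).

Definition sbar (n : nat) := (spinor n./2 * spinor n./2)%type.

Definition ebar n (l : 'I_n) (u : sbar n) : sbar n :=
  (@gam n l u.1, fun s => - @gam n l u.2 s).
Definition e0 n (u : sbar n) : sbar n := (u.2, u.1).
Definition iscale n (u : sbar n) : sbar n := (fun s => 'i * u.1 s, fun s => 'i * u.2 s).

Definition bdot n (u v : sbar n) : C := sdot u.1 v.1 + sdot u.2 v.2.

Definition Nsp n (u : sbar n) : R := complex.Re (bdot u u).
(* X(u) = <e_i e0 u, u> e_i ; Y(u) = <i e_i u, u> e_i (both are real) *)
Definition Xsp n (u : sbar n) : 'rV[R]_n :=
  \row_(i < n) complex.Re (bdot (ebar i (e0 u)) u).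
Definition Ysp n (u : sbar n) : 'rV[R]_n :=
  \row_(i < n) complex.Re (bdot (iscale (ebar i u)) u).
Definition omegasp n (u : sbar n) : 'M[R]_n :=
  \matrix_(i < n, j < n) complex.Im (bdot (ebar i (ebar j (e0 u))) u).

Definition vdot n (v w : 'rV[R]_n) : R := \sum_(i < n) v 0 i * w 0 i.
Definition vnorm n (v : 'rV[R]_n) : R := Num.sqrt (vdot v v).

Definition two_form n (A : 'M[R]_n) : Prop := A^T = - A.
Definition wedge n (v w : 'rV[R]_n) : 'M[R]_n :=
  \matrix_(i < n, j < n) (v 0 i * w 0 j - v 0 j * w 0 i).
Definition fdot n (A B : 'M[R]_n) : R :=
  \sum_(i < n) \sum_(j < n | (i < j)%N) A i j * B i j.

Definition simple_form n (A : 'M[R]_n) : Prop :=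
  exists (a : R) (e1 e2 : 'rV[R]_n),
    [/\ vdot e1 e1 = 1, vdot e2 e2 = 1, vdot e1 e2 = 0 & A = a *: wedge e1 e2].

Definition Ffun n (Cv Pv : 'rV[R]_n) (A : 'M[R]_n) (u : sbar n) : R :=
  vdot Cv (Xsp u) + vdot Pv (Ysp u) + fdot A (omegasp u).

End Spinors.

(* Main.v *)
Require Import Defs.
From HB Require Import structures.
From mathcomp Require Import all_boot all_order all_algebra.
From mathcomp Require Import complex.
From Stdlib Require Import FunctionalExtensionality.
From mathcomp Require Import ring lra zify.
Import Order.TTheory GRing.Theory Num.Theory.
Local Open Scope ring_scope.

Set Implicit Arguments.
Unset Strict Implicit.
Unset Printing Implicit Defensive.

(** For vectors v, the operators E v = v e_0 and G v = i v are self-adjoint and square to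
    |v|^2, so that X(u).v = <E v u, u> and Y(u).v = <G v u, u>, and for orthogonal f, g the
    two-form operator f /\ g is the product E f o G g of commuting involutions.
    Replacing F by -F, its maximum is sought.  In each of the three cases an adapted
    orthonormal frame writes F(u) as <(l A + m B + k D) u, u>, where A, B, D are self-adjoint
    involutions, B anticommutes with A and D, and l k >= 0.  Then A u and D u are orthogonal
    to B u, and Cauchy-Schwarz bounds F by M = sqrt ((l + k)^2 + m^2) on unit vectors.
    For suitable orthonormal x, y the value M is attained at any unit vector u fixed by
    both E x and G y, and such u satisfies X(u) = x and Y(u) = y.  A vector orthogonal to
    x and y (here n >= 3 enters) shows that such u exists. *)

(** * Euclidean vectors and the pairing of two-forms *)

Section EuclideanVectors.
Variables (R : rcfType) (n : nat).
Implicit Types v w f g z : 'rV[R]_n.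

Lemma vdotC v w : vdot v w = vdot w v.
Proof. by apply: eq_bigr => i _; rewrite mulrC. Qed.

Lemma vdotDl v w z : vdot (v + w) z = vdot v z + vdot w z.
Proof. by rewrite /vdot -big_split; apply: eq_bigr => i _; rewrite mxE mulrDl. Qed.

Lemma vdotZl a v z : vdot (a *: v) z = a * vdot v z.
Proof. by rewrite /vdot mulr_sumr; apply: eq_bigr => i _; rewrite mxE mulrA. Qed.

Lemma vdotNl v z : vdot (- v) z = - vdot v z.
Proof. by rewrite -scaleN1r vdotZl mulN1r. Qed.

Lemma vdotDr v w z : vdot z (v + w) = vdot z v + vdot z w.
Proof. by rewrite vdotC vdotDl !(vdotC z). Qed.

Lemma vdotZr a v z : vdot z (a *: v) = a * vdot z v.
Proof. by rewrite vdotC vdotZl (vdotC z). Qed.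

Lemma vdotNr v z : vdot z (- v) = - vdot z v.
Proof. by rewrite vdotC vdotNl (vdotC z). Qed.

Definition vdotE := (vdotDl, vdotDr, vdotNl, vdotNr, vdotZl, vdotZr).

Lemma vdot_ge0 v : 0 <= vdot v v.
Proof. by apply: sumr_ge0 => i _; rewrite -expr2 sqr_ge0. Qed.

Lemma vdot_eq0 v : vdot v v = 0 -> v = 0.
Proof.
move=> /psumr_eq0P v0; apply/rowP => i; rewrite mxE.
have /eqP : v 0 i * v 0 i = 0 by apply: v0 => // j _; rewrite -expr2 sqr_ge0.
by rewrite mulf_eq0 orbb => /eqP.
Qed.

Lemma normalize v : v != 0 ->
  exists z q, [/\ vdot z z = 1, 0 <= q & v = q *: z].
Proof.
move=> v0; set q := Num.sqrt (vdot v v).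
have q2 : q ^+ 2 = vdot v v by rewrite sqr_sqrtr ?vdot_ge0.
have q0 : q != 0.
  apply: contraNneq v0 => q0; apply/eqP/vdot_eq0.
  by rewrite -q2 q0 expr0n.
exists (q^-1 *: v), q; split; first by rewrite !vdotE -q2; field.
  by rewrite sqrtr_ge0.
by rewrite scalerA mulfV ?scale1r.
Qed.

(** Orthogonality to [f] and [g] means lying in the left kernel of an [n] by 2 matrix, which is
    nonzero because the rank is at most 2. Every use of [3 <= n] goes back to this kernel. *)
Lemma exists_unit_orthogonal f g : (3 <= n)%N ->
  exists z, [/\ vdot z z = 1, vdot z f = 0 & vdot z g = 0].
Proof.
move=> n3; pose B := (col_mx f g)^T.
have : kermx B != 0.
  rewrite -mxrank_eq0 mxrank_ker -lt0n subn_gt0.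
  exact: leq_ltn_trans (rank_leq_col _) n3.
case/rowV0Pn => v /sub_kermxP; rewrite /B tr_col_mx mul_mx_row => vB v0.
have [vf vg] : vdot v f = 0 /\ vdot v g = 0.
  have vdot_mx w : vdot v w = (v *m w^T) 0 0.
    by rewrite mxE; apply: eq_bigr => i _; rewrite mxE.
  move: vB; rewrite -[0]row_mx0 => /eq_row_mx[vf vg].
  by rewrite !vdot_mx vf vg mxE.
have [z [q [zz _ vE]]] := normalize v0.
have q0 : q != 0 by apply: contraNneq v0 => q0; rewrite vE q0 scale0r.
exists z; split => //; apply: (mulfI q0); rewrite mulr0 -vdotZl -vE //.
Qed.

(** When [v = 0] the direction [z] is any unit vector orthogonal to [f] and [g], so that degenerate
    coefficients need no separate treatment later. *)
Lemma polar_orthogonal v f g : (3 <= n)%N -> vdot v f = 0 -> vdot v g = 0 ->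
  exists z q, [/\ vdot z z = 1, vdot z f = 0, vdot z g = 0, 0 <= q & v = q *: z].
Proof.
move=> n3 vf vg; have [->|v0] := eqVneq v 0.
  have [z [zz zf zg]] := exists_unit_orthogonal f g n3.
  by exists z, 0; rewrite scale0r.
have [z [q [zz qge0 vE]]] := normalize v0.
have q0 : q != 0 by apply: contraNneq v0 => q0; rewrite vE q0 scale0r.
by exists z, q; split => //; apply: (mulfI q0); rewrite mulr0 -vdotZl -vE.
Qed.

(** Antisymmetry turns the [- f_j g_i] half of the sum over [i < j] into the terms below the
    diagonal, and the diagonal terms vanish. *)
Lemma fdot_wedge (f g : 'rV[R]_n) (B : 'M[R]_n) : (forall i j, B i j = - B j i) ->
  fdot (wedge f g) B = \sum_i \sum_j f 0 i * g 0 j * B i j.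
Proof.
move=> anti; pose T i j := f 0 i * g 0 j * B i j.
have T0 i : T i i = 0.
  have H := anti i i; have B0 : B i i = 0 by lra.
  by rewrite /T B0 mulr0.
have H : \sum_i \sum_j T i j =
    \sum_(i < n) \sum_(j < n) (if (i < j)%N then T i j else 0)
  + \sum_(i < n) \sum_(j < n) (if (j < i)%N then T i j else 0).
  rewrite -big_split; apply: eq_bigr => i _; rewrite -big_split; apply: eq_bigr => j _.
  by case: ltngtP => [||/val_inj->] /=; rewrite ?T0 ?addr0 ?add0r.
rewrite [RHS]H {H}.
rewrite [X in _ + X]exchange_big -big_split; apply: eq_bigr => i _.
rewrite -big_split big_mkcond; apply: eq_bigr => j _ /=; case: ifP => _; last by rewrite addr0.
by rewrite mxE /T (anti j i); ring.
Qed.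

Lemma fdotZl a (A B : 'M[R]_n) : fdot (a *: A) B = a * fdot A B.
Proof.
rewrite mulr_sumr; apply: eq_bigr => i _; rewrite mulr_sumr; apply: eq_bigr => j _.
by rewrite mxE mulrA.
Qed.

End EuclideanVectors.

Lemma polar_coordinates (R : rcfType) (p q : R) :
  exists r c s, [/\ 0 <= r, c ^+ 2 + s ^+ 2 = 1, p = r * c & q = r * s].
Proof.
set r := Num.sqrt (p ^+ 2 + q ^+ 2).
have r2 : r ^+ 2 = p ^+ 2 + q ^+ 2 by rewrite sqr_sqrtr ?addr_ge0 ?sqr_ge0.
have [r0|r0] := eqVneq r 0.
  have /eqP := r2; rewrite r0 expr0n eq_sym paddr_eq0 ?sqr_ge0 // !sqrf_eq0.
  (* At the origin the angle is arbitrary; angle zero still gives a point of the unit circle. *)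
  by case/andP=> /eqP-> /eqP->; exists 0, 1, 0; split; rewrite ?lexx//; ring.
exists r, (p / r), (q / r); split; rewrite ?sqrtr_ge0 //; try by field.
by rewrite !expr_div_n -mulrDl -r2 mulfV // sqrf_eq0.
Qed.

(** * An abstract real Clifford module with a Euclidean inner product *)

Section CliffordModule.
Variables (R : rcfType) (V : lmodType R) (n : nat) (ip : V -> V -> R).
Hypothesis ipC : forall u w, ip u w = ip w u.
Hypothesis ipDl : forall u v w, ip (u + v) w = ip u w + ip v w.
Hypothesis ipZl : forall a u w, ip (a *: u) w = a * ip u w.
Hypothesis ip_ge0 : forall u, 0 <= ip u u.
Hypothesis ip_eq0 : forall u, ip u u = 0 -> u = 0.
(* ez stands for e_0 and I for multiplication by the imaginary unit. *)
Variables (e : 'I_n -> {linear V -> V}) (ez I : {linear V -> V}).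
Hypothesis e_cliff : forall i j u,
  e i (e j u) + e j (e i u) = (- 2 * (i == j)%:R) *: u.
Hypothesis e_skew : forall i u w, ip (e i u) w = - ip u (e i w).
Hypothesis ez_ez : forall u, ez (ez u) = u.
Hypothesis ez_e : forall i u, ez (e i u) = - e i (ez u).
Hypothesis ez_sym : forall u w, ip (ez u) w = ip u (ez w).
Hypothesis I_I : forall u, I (I u) = - u.
Hypothesis I_e : forall i u, I (e i u) = e i (I u).
Hypothesis I_ez : forall u, I (ez u) = ez (I u).
Hypothesis I_skew : forall u w, ip (I u) w = - ip u (I w).

Implicit Types (u t : V) (x y z f g v w : 'rV[R]_n) (a b c : R).

Lemma ipNl u t : ip (- u) t = - ip u t.
Proof. by rewrite -scaleN1r ipZl mulN1r. Qed.

Lemma ipDr u u' t : ip t (u + u') = ip t u + ip t u'.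
Proof. by rewrite ipC ipDl !(ipC t). Qed.

Lemma ipZr a u t : ip t (a *: u) = a * ip t u.
Proof. by rewrite ipC ipZl (ipC t). Qed.

Lemma ipNr u t : ip t (- u) = - ip t u.
Proof. by rewrite ipC ipNl (ipC t). Qed.

Definition ipE := (ipDl, ipDr, ipNl, ipNr, ipZl, ipZr).

Lemma ip_sumr (J : Type) (r : seq J) (F : J -> V) t :
  ip t (\sum_(i <- r) F i) = \sum_(i <- r) ip t (F i).
Proof.
elim: r => [|j r IH]; last by rewrite !big_cons ipDr IH.
by rewrite !big_nil -(scale0r t) ipZr mul0r.
Qed.

Lemma ip_suml (J : Type) (r : seq J) (F : J -> V) t :
  ip (\sum_(i <- r) F i) t = \sum_(i <- r) ip (F i) t.
Proof. by rewrite ipC ip_sumr; apply: eq_bigr => i _; rewrite ipC. Qed.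

(** [<A u, B u> = <u, A B u> = - <u, B A u> = - <B u, A u>], so this number is its own negative. *)
Lemma anticommuting_orthogonal (A B : V -> V) u :
  (forall u t, ip (A u) t = ip u (A t)) -> (forall u t, ip (B u) t = ip u (B t)) ->
  A (B u) = - B (A u) -> ip (A u) (B u) = 0.
Proof.
move=> sA sB AB; have := sA u (B u); rewrite AB ipNr -(sB u (A u)) (ipC (B u)) => H; lra.
Qed.

(** Since [<p, r> <= 1] and [l k >= 0], the vector [l p + m q + k r] has squared norm at most
    [(l + k)^2 + m^2 = M^2]; Cauchy-Schwarz against [u] then gives the bound. *)
Lemma unit_triple_bound (p q r u : V) (l m k M c s : R) :
  ip u u = 1 -> ip p p = 1 -> ip q q = 1 -> ip r r = 1 ->
  ip p q = 0 -> ip r q = 0 -> 0 <= l * k ->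
  0 <= M -> c ^+ 2 + s ^+ 2 = 1 -> l + k = M * c -> m = M * s ->
  l * ip p u + m * ip q u + k * ip r u <= M.
Proof.
move=> uu pp qq rr pq rq lk M0 cs lkE mE.
have pr1 : ip p r <= 1.
  have := ip_ge0 (p - r); rewrite !ipE pp rr (ipC r p) => H; lra.
have M2 : M ^+ 2 = (l + k) ^+ 2 + m ^+ 2.
  by rewrite lkE mE !exprMn -mulrDr cs mulr1.
set t := l * ip p u + _ + _.
(* This is Cauchy-Schwarz in the form that the squared distance from [l p + m q + k r] to [M u] is
   nonnegative. *)
have H : 2 * M * t <= 2 * M ^+ 2.
  have := ip_ge0 (l *: p + m *: q + k *: r - M *: u).
  have -> : ip (l *: p + m *: q + k *: r - M *: u) (l *: p + m *: q + k *: r - M *: u)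
      = (l + k) ^+ 2 + m ^+ 2 - 2 * (l * k * (1 - ip p r)) + M ^+ 2 - 2 * M * t.
    rewrite !ipE uu pp qq rr (ipC q p) (ipC q r) pq rq (ipC r p).
    by rewrite (ipC u p) (ipC u q) (ipC u r) /t; ring.
  have : 0 <= l * k * (1 - ip p r) by rewrite mulr_ge0 // subr_ge0.
  by rewrite -M2; lra.
(* Cancelling [M] fails for [M = 0], but then [l + k = 0] together with [l k >= 0] forces all three
   coefficients to vanish. *)
have [M0'|Mn0] := eqVneq M 0; last first.
  have Mp : 0 < M by rewrite lt_def Mn0.
  by rewrite -(ler_pM2l Mp); nra.
have m0 : m = 0 by rewrite mE M0' mul0r.
have kE : k = - l by apply/eqP; rewrite -addr_eq0 addrC lkE M0' mul0r.
have l0 : l = 0.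
  by apply/eqP; rewrite -sqrf_eq0 eq_le sqr_ge0 andbT; move: lk; rewrite kE; nra.
by rewrite /t kE m0 l0 M0' oppr0 !mul0r !addr0.
Qed.

(** * Clifford multiplication by vectors and the operators [E] and [G] *)

Definition ev v u : V := \sum_i v 0 i *: e i u.

Lemma evDl v w u : ev (v + w) u = ev v u + ev w u.
Proof. by rewrite /ev -big_split; apply: eq_bigr => i _; rewrite mxE scalerDl. Qed.

Lemma evZl a v u : ev (a *: v) u = a *: ev v u.
Proof. by rewrite /ev scaler_sumr; apply: eq_bigr => i _; rewrite mxE scalerA. Qed.

Lemma ev_is_linear v : linear (ev v).
Proof.
move=> a u t; rewrite /ev scaler_sumr -big_split; apply: eq_bigr => i _.
by rewrite linearP scalerDr !scalerA mulrC.
Qed.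
HB.instance Definition _ v := GRing.isLinear.Build R V V _ (ev v) (ev_is_linear v).

Lemma ev_skew v u t : ip (ev v u) t = - ip u (ev v t).
Proof.
rewrite ip_suml ip_sumr -sumrN; apply: eq_bigr => i _.
by rewrite ipZl ipZr e_skew mulrN.
Qed.

Lemma ez_ev v u : ez (ev v u) = - ev v (ez u).
Proof.
rewrite linear_sum -sumrN; apply: eq_bigr => i _.
by rewrite linearZ /= ez_e scalerN.
Qed.

Lemma I_ev v u : I (ev v u) = ev v (I u).
Proof. by rewrite linear_sum; apply: eq_bigr => i _; rewrite linearZ /= I_e. Qed.

Lemma ev_evE v w u : ev v (ev w u) = \sum_i \sum_j (v 0 i * w 0 j) *: e i (e j u).
Proof.
apply: eq_bigr => i _; rewrite linear_sum scaler_sumr; apply: eq_bigr => j _.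
by rewrite linearZ /= scalerA.
Qed.

Lemma ev_cliff v w u : ev v (ev w u) + ev w (ev v u) = (- 2 * vdot v w) *: u.
Proof.
(* Exchanging the sums of the second term pairs [e_i e_j] with [e_j e_i], and only the diagonal
   survives. *)
rewrite !ev_evE [X in _ + X]exchange_big -big_split /vdot mulr_sumr scaler_suml.
apply: eq_bigr => i _; rewrite -big_split (bigD1 i) //= big1 => [|j ji].
  by rewrite (mulrC (w 0 i)) -scalerDr e_cliff eqxx scalerA mulr1 addr0 mulrC.
by rewrite (mulrC (w 0 j)) -scalerDr e_cliff eq_sym (negPf ji) mulr0 scale0r scaler0.
Qed.

Definition E v u : V := ev v (ez u).
Definition G v u : V := I (ev v u).

Lemma E_is_linear v : linear (E v).
Proof. by move=> a u t; rewrite /E !linearP. Qed.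
HB.instance Definition _ v := GRing.isLinear.Build R V V _ (E v) (E_is_linear v).

Lemma G_is_linear v : linear (G v).
Proof. by move=> a u t; rewrite /G !linearP. Qed.
HB.instance Definition _ v := GRing.isLinear.Build R V V _ (G v) (G_is_linear v).

Lemma EDl v w u : E (v + w) u = E v u + E w u. Proof. exact: evDl. Qed.
Lemma EZl a v u : E (a *: v) u = a *: E v u. Proof. exact: evZl. Qed.
Lemma GDl v w u : G (v + w) u = G v u + G w u. Proof. by rewrite /G evDl linearD. Qed.
Lemma GZl a v u : G (a *: v) u = a *: G v u. Proof. by rewrite /G evZl linearZ. Qed.

Lemma E_sym v u t : ip (E v u) t = ip u (E v t).
Proof. by rewrite /E ev_skew ez_sym ez_ev ipNr opprK. Qed.

Lemma G_sym v u t : ip (G v u) t = ip u (G v t).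
Proof. by rewrite /G I_skew ev_skew opprK I_ev. Qed.

Lemma E_E v w u : E v (E w u) = - ev v (ev w u).
Proof. by rewrite /E ez_ev linearN ez_ez. Qed.

Lemma G_G v w u : G v (G w u) = - ev v (ev w u).
Proof. by rewrite /G -I_ev I_I. Qed.

(** Moving [ez] past [w] costs a sign, so [E v G w = - G v E w] for all [v] and [w]. Hence [E] and
    [G] anticommute on the same vector; on orthogonal vectors a second sign, from swapping the
    vectors, makes them commute. *)
Lemma E_G v w u : E v (G w u) = - I (ev v (ev w (ez u))).
Proof. by rewrite /E /G -I_ez ez_ev !linearN /= -I_ev. Qed.

Lemma G_E v w u : G v (E w u) = I (ev v (ev w (ez u))).
Proof. by []. Qed.

Lemma E_cliff v w u : E v (E w u) + E w (E v u) = (2 * vdot v w) *: u.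
Proof. by rewrite !E_E -opprD ev_cliff mulNr scaleNr opprK. Qed.

Lemma G_cliff v w u : G v (G w u) + G w (G v u) = (2 * vdot v w) *: u.
Proof. by rewrite !G_G -opprD ev_cliff mulNr scaleNr opprK. Qed.

Lemma E_anticomm v w u : vdot v w = 0 -> E v (E w u) = - E w (E v u).
Proof.
by move=> vw; apply/eqP; rewrite -addr_eq0 E_cliff vw mulr0 scale0r.
Qed.

Lemma G_anticomm v w u : vdot v w = 0 -> G v (G w u) = - G w (G v u).
Proof.
by move=> vw; apply/eqP; rewrite -addr_eq0 G_cliff vw mulr0 scale0r.
Qed.

Lemma EG_anticomm v u : E v (G v u) = - G v (E v u).
Proof. by rewrite E_G G_E. Qed.

Lemma ev_anticomm v w u : vdot v w = 0 -> ev v (ev w u) = - ev w (ev v u).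
Proof.
by move=> vw; apply/eqP; rewrite -addr_eq0 ev_cliff vw mulr0 scale0r.
Qed.

Lemma EG_comm v w u : vdot v w = 0 -> E v (G w u) = G w (E v u).
Proof. by move=> vw; rewrite E_G G_E ev_anticomm // linearN opprK. Qed.

Lemma ev_sqr v u : vdot v v = 1 -> ev v (ev v u) = - u.
Proof.
move=> v1; have := ev_cliff v v u; rewrite v1 mulr1 -mulr2n -scaler_nat scaleNr => H.
have two : (2 : R) != 0 by rewrite pnatr_eq0.
by apply: (scalerI two); rewrite H scalerN.
Qed.

Lemma E_invol v u : vdot v v = 1 -> E v (E v u) = u.
Proof. by move=> v1; rewrite E_E ev_sqr ?opprK. Qed.

Lemma G_invol v u : vdot v v = 1 -> G v (G v u) = u.
Proof. by move=> v1; rewrite G_G ev_sqr ?opprK. Qed.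

Lemma E_isom v u : vdot v v = 1 -> ip (E v u) (E v u) = ip u u.
Proof. by move=> v1; rewrite E_sym E_invol. Qed.

Lemma G_isom v u : vdot v v = 1 -> ip (G v u) (G v u) = ip u u.
Proof. by move=> v1; rewrite G_sym G_invol. Qed.

Lemma E_orth v w u : vdot v w = 0 -> ip (E v u) (E w u) = 0.
Proof.
by move=> vw; apply: (anticommuting_orthogonal (E_sym v) (E_sym w)); exact: E_anticomm.
Qed.

Lemma G_orth v w u : vdot v w = 0 -> ip (G v u) (G w u) = 0.
Proof.
by move=> vw; apply: (anticommuting_orthogonal (G_sym v) (G_sym w)); exact: G_anticomm.
Qed.

Lemma EG_orth v u : ip (E v u) (G v u) = 0.
Proof. apply: (anticommuting_orthogonal (E_sym v) (G_sym v)); exact: EG_anticomm. Qed.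

Lemma EG_sym v w u t : vdot v w = 0 -> ip (E v (G w u)) t = ip u (E v (G w t)).
Proof. by move=> vw; rewrite E_sym G_sym EG_comm. Qed.

(** [E z] anticommutes with [E f] and commutes with [G g], hence anticommutes with their product. *)
Lemma EG_E_orth f g z u : vdot f g = 0 -> vdot f z = 0 -> vdot z g = 0 ->
  ip (E f (G g u)) (E z u) = 0.
Proof.
move=> fg fz zg; apply: (@anticommuting_orthogonal (E f \o G g)) => [a b||] /=.
- exact: EG_sym.
- exact: E_sym.
- by rewrite -EG_comm // E_anticomm.
Qed.

(** Here [G z] commutes with [E f] and anticommutes with [G g]. *)
Lemma EG_G_orth f g z u : vdot f g = 0 -> vdot f z = 0 -> vdot z g = 0 ->
  ip (E f (G g u)) (G z u) = 0.
Proof.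
move=> fg fz zg; apply: (@anticommuting_orthogonal (E f \o G g)) => [a b||] /=.
- exact: EG_sym.
- exact: G_sym.
- by rewrite G_anticomm 1?vdotC // linearN /= EG_comm.
Qed.

(** The two-form [f /\ g] is invariant under rotations of its plane: in the Clifford product
    [(c f - s g)(s f + c g)] the squares cancel and [(c^2 + s^2) f g] remains. *)
Lemma EG_rotate f g c s u : vdot f f = 1 -> vdot g g = 1 -> vdot f g = 0 ->
  c ^+ 2 + s ^+ 2 = 1 ->
  E (c *: f - s *: g) (G (s *: f + c *: g) u) = E f (G g u).
Proof.
move=> ff gg fg cs; rewrite !E_G; congr (- I _).
have ev_fl t : ev (c *: f - s *: g) t = c *: ev f t - s *: ev g t.
  by rewrite evDl -scaleNr !evZl scaleNr.
rewrite ev_fl evDl !evZl [ev f (_ + _)]linearD [ev g (_ + _)]linearD /=.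
rewrite ![ev f (_ *: _)]linearZ ![ev g (_ *: _)]linearZ /= !ev_sqr // (@ev_anticomm g f) 1?vdotC //.
rewrite !scalerDr !scalerN !scalerA !opprD !opprK (mulrC s c).
by rewrite (addrC ((s * s) *: _)) addrACA addNr add0r -scalerDl -!expr2 cs scale1r.
Qed.

(** * Joint eigenvectors of [E x] and [G y] *)

Lemma E_neq0 v u : vdot v v = 1 -> u != 0 -> E v u != 0.
Proof.
by move=> vv; apply: contraNneq => Evu; rewrite -(E_invol u vv) Evu linear0.
Qed.

Lemma G_neq0 v u : vdot v v = 1 -> u != 0 -> G v u != 0.
Proof.
by move=> vv; apply: contraNneq => Gvu; rewrite -(G_invol u vv) Gvu linear0.
Qed.

(* A third direction z anticommutes past E x (via E z) or past G y (via G z),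
   hence swaps the two eigenspaces of one involution and keeps those of the other. *)
Lemma joint_eigenvector x y u0 : (3 <= n)%N -> u0 != 0 ->
  vdot x x = 1 -> vdot y y = 1 -> vdot x y = 0 ->
  exists u, [/\ ip u u = 1, E x u = u & G y u = u].
Proof.
move=> n3 u0n xx yy xy; have [z [zz zx zy]] := exists_unit_orthogonal x y n3.
have [u1 u1n Eu1] : exists2 u1, u1 != 0 & E x u1 = u1.
  (* [u0 + E x u0] is twice the projection of [u0] to the fixed space of [E x]; if it vanishes,
     [E x u0 = - u0] and [E z] carries [u0] into that space. *)
  have [Eu0|Eu0] := eqVneq (u0 + E x u0) 0.
    exists (E z u0); first exact: E_neq0.
    rewrite E_anticomm 1?vdotC // -linearN /=; congr (E z _).
    by apply/eqP; rewrite eq_sym -addr_eq0 Eu0.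
  by exists (u0 + E x u0) => //; rewrite linearD /= E_invol // addrC.
have [u2 u2n [Eu2 Gu2]] : exists2 u2, u2 != 0 & E x u2 = u2 /\ G y u2 = u2.
  (* The same argument for [G y]; both [G y] and [G z] commute with [E x], so the first eigenvalue
     is kept. *)
  have [Gu1|Gu1] := eqVneq (u1 + G y u1) 0.
    exists (G z u1); first exact: G_neq0.
    split; first by rewrite EG_comm 1?vdotC // Eu1.
    rewrite G_anticomm 1?vdotC // -linearN /=; congr (G z _).
    by apply/eqP; rewrite eq_sym -addr_eq0 Gu1.
  exists (u1 + G y u1) => //.
  by split; rewrite linearD /= ?EG_comm ?Eu1 // G_invol // addrC.
have [r r0 r2] : exists2 r, r != 0 & ip u2 u2 = r ^+ 2.
  exists (Num.sqrt (ip u2 u2)); last by rewrite sqr_sqrtr.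
  by rewrite sqrtr_eq0 -ltNge lt_def ip_ge0 andbT; apply: contraNneq u2n => /ip_eq0->.
exists (r^-1 *: u2); split; rewrite ?linearZ /= ?Eu2 ?Gu2 // !ipE r2; field.
exact: r0.
Qed.

(** Pairing [E v E x + E x E v = 2 <v, x>] with [u] and using [E x u = u] twice gives twice the
    claim. Thus [X(u) = x]. *)
Lemma E_expectation x v u : ip u u = 1 -> E x u = u -> ip (E v u) u = vdot v x.
Proof.
move=> uu Exu; have /(congr1 (ip ^~ u)) := E_cliff v x u.
rewrite Exu !ipE (E_sym x) Exu uu => H; lra.
Qed.

Lemma G_expectation y v u : ip u u = 1 -> G y u = u -> ip (G v u) u = vdot v y.
Proof.
move=> uu Gyu; have /(congr1 (ip ^~ u)) := G_cliff v y u.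
rewrite Gyu !ipE (G_sym y) Gyu uu => H; lra.
Qed.

(** * The three maximisation problems *)

Definition attains_max (F : V -> R) :=
  exists x y u, [/\ vdot x x = 1, vdot y y = 1, ip u u = 1,
    E x u = u /\ G y u = u & forall t, ip t t = 1 -> F t <= F u].

(** A bound that is reached on joint eigenvectors suffices, because such eigenvectors exist.
    [attains_max] keeps the fixed-point relations since [|X(u)| = |Y(u)| = 1] is read off from
    them. *)
Lemma attains_max_of_bound x y u0 (F : V -> R) M : (3 <= n)%N -> u0 != 0 ->
  vdot x x = 1 -> vdot y y = 1 -> vdot x y = 0 ->
  (forall t, ip t t = 1 -> F t <= M) ->
  (forall u, ip u u = 1 -> E x u = u -> G y u = u -> F u = M) ->
  attains_max F.
Proof.
move=> n3 u0n xx yy xy FM Fu; have [u [uu Eu Gu]] := joint_eigenvector n3 u0n xx yy xy.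
by exists x, y, u; split=> // t tt; rewrite (Fu u) // FM.
Qed.

(** With [x = c f] and [y = p f + q g], where [c] and [q] are nonnegative, [G f] anticommutes with
    both [E f] and [G g], so it supplies the middle vector of [unit_triple_bound]. *)
Lemma max_energy_EG x y u0 : (3 <= n)%N -> u0 != 0 ->
  attains_max (fun u => ip (E x u) u + ip (G y u) u).
Proof.
move=> n3 u0n.
(* The orthogonality constraints are trivial here; only a unit [f] and [c >= 0] are wanted, also
   when [x = 0]. *)
have [f [c [ff _ _ c0 ->]]] : exists f c,
    [/\ vdot f f = 1, vdot f 0 = 0, vdot f 0 = 0, 0 <= c & x = c *: f].
  by apply: polar_orthogonal => //; rewrite -(scale0r 0) vdotZr mul0r.
pose p := vdot y f.
have yf : vdot (y - p *: f) f = 0 by rewrite !vdotE ff mulr1 subrr.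
have [g [q [gg gf _ q0 yE]]] := polar_orthogonal n3 yf yf.
have fg : vdot f g = 0 by rewrite vdotC.
have [M [b [s [M0 bs cqE pE]]]] := polar_coordinates (c + q) p.
have {}yE : y = p *: f + q *: g by rewrite -yE addrC subrK.
(* Pairing [x] and [y] with this rotated frame gives [(c + q) b + p s]; the polar angle of
   [(c + q, p)] makes it equal to [M]. *)
apply: (@attains_max_of_bound (b *: f - s *: g) (s *: f + b *: g) u0 _ M) => //.
- by rewrite !vdotE ff gg fg gf; apply: etrans bs; ring.
- by rewrite !vdotE ff gg fg gf; apply: etrans bs; ring.
- by rewrite !vdotE ff gg fg gf; ring.
- move=> t tt; rewrite yE EZl GDl !GZl !ipE addrA.
  apply: (@unit_triple_bound _ _ _ _ c p q M b s) => //.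
  + by rewrite E_isom. + by rewrite G_isom. + by rewrite G_isom.
  + exact: EG_orth. + exact: G_orth. + exact: mulr_ge0.
- move=> u uu Eu Gu; rewrite (E_expectation _ uu Eu) (G_expectation _ uu Gu) yE !vdotE.
  rewrite ff gg fg gf; transitivity ((c + q) * b + p * s); first by ring.
  by rewrite cqE pE -[RHS]mulr1 -bs; ring.
Qed.

(* g' is the direction of the component of y in the plane of f and g; its sign is
   chosen so that the coefficients a and r satisfy the sign condition of
   unit_triple_bound. *)
Lemma adapted_frame a y f g : (3 <= n)%N ->
  vdot f f = 1 -> vdot g g = 1 -> vdot f g = 0 ->
  exists f' g' z r q, [/\ vdot f' f' = 1, vdot g' g' = 1 & vdot f' g' = 0] /\
    [/\ vdot z z = 1, vdot z f' = 0, vdot z g' = 0, 0 <= a * r & y = r *: g' + q *: z]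
    /\ forall u, E f' (G g' u) = E f (G g u).
Proof.
move=> n3 ff gg fg; have gf : vdot g f = 0 by rewrite vdotC.
have [r [c [s [ar cs yg yf]]]] : exists r c s, [/\ 0 <= a * r,
    c ^+ 2 + s ^+ 2 = 1, vdot y g = r * c & vdot y f = r * s].
  have [r [c [s [r0 cs yg yf]]]] := polar_coordinates (vdot y g) (vdot y f).
  have [a0|a0] := leP 0 a; first by exists r, c, s; rewrite mulr_ge0.
  exists (- r), (- c), (- s); rewrite !mulrNN !sqrrN mulrN -mulNr.
  by rewrite mulr_ge0 // oppr_ge0 ltW.
pose f' := c *: f - s *: g; pose g' := s *: f + c *: g.
have zf : vdot (y - r *: g') f' = 0.
  rewrite !vdotE ff gg fg gf yg yf; ring.
have zg : vdot (y - r *: g') g' = 0.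
  rewrite !vdotE ff gg fg gf yg yf; ring: cs.
have [z [q [zz zf' zg' _ yE]]] := polar_orthogonal n3 zf zg.
exists f', g', z, r, q; split; last split.
- by split; rewrite !vdotE ff gg fg gf; try (apply: etrans cs); ring.
- by split => //; rewrite -yE addrC subrK.
- by move=> u; apply: EG_rotate.
Qed.

(** With [y = r g' + q z], [G z] anticommutes with [G g'] and with [E f' G g']. On vectors fixed by
    [E f'] the latter two have the same expectation, so their coefficients add up to [r + a]. *)
Lemma max_energy_GW y a f g u0 : (3 <= n)%N -> u0 != 0 ->
  vdot f f = 1 -> vdot g g = 1 -> vdot f g = 0 ->
  attains_max (fun u => ip (G y u) u + a * ip (E f (G g u)) u).
Proof.
move=> n3 u0n ff0 gg0 fg0.
have [f' [g' [z [r [q [[ff gg fg] [[zz zf zg ar yE] W]]]]]]] := adapted_frame a y n3 ff0 gg0 fg0.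
have fz : vdot f' z = 0 by rewrite vdotC.
have gz : vdot g' z = 0 by rewrite vdotC.
have [M [b [s [M0 bs raE qE]]]] := polar_coordinates (r + a) q.
apply: (@attains_max_of_bound f' (b *: g' + s *: z) u0 _ M) => //.
- by rewrite !vdotE gg zz zg gz; apply: etrans bs; ring.
- by rewrite !vdotE fg fz; ring.
- move=> t tt; rewrite yE GDl !GZl !ipE -W.
  apply: (@unit_triple_bound _ _ _ _ r q a M b s) => //.
  + by rewrite G_isom. + by rewrite G_isom. + by rewrite E_isom // G_isom.
  + exact: G_orth. + exact: EG_G_orth. + by rewrite mulrC.
- move=> u uu Eu Gu; rewrite -W E_sym Eu !(G_expectation _ uu Gu) yE !vdotE.
  rewrite gg zz zg gz; transitivity ((r + a) * b + q * s); first by ring.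
  by rewrite raE qE -[RHS]mulr1 -bs; ring.
Qed.

(** The planar component of [x] has to lie along the first factor of the two-form, so
    [adapted_frame] is applied to [g, f]. Swapping the factors before and after the rotation
    produces two signs, which cancel. *)
Lemma max_energy_EW x a f g u0 : (3 <= n)%N -> u0 != 0 ->
  vdot f f = 1 -> vdot g g = 1 -> vdot f g = 0 ->
  attains_max (fun u => ip (E x u) u + a * ip (E f (G g u)) u).
Proof.
move=> n3 u0n ff0 gg0 fg0; have gf0 : vdot g f = 0 by rewrite vdotC.
have [g' [f' [z [r [q [[gg ff gf] [[zz zg zf ar xE] W]]]]]]] :=
  adapted_frame a x n3 gg0 ff0 gf0.
have fg : vdot f' g' = 0 by rewrite vdotC.
have fz : vdot f' z = 0 by rewrite vdotC.
have EG_skew h h' u : vdot h h' = 0 -> E h (G h' u) = - E h' (G h u).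
  by move=> hh; rewrite !E_G ev_anticomm // linearN.
have {}W u : E f' (G g' u) = E f (G g u) by rewrite EG_skew // W EG_skew // opprK.
have [M [b [s [M0 bs raE qE]]]] := polar_coordinates (r + a) q.
apply: (@attains_max_of_bound (b *: f' + s *: z) g' u0 _ M) => //.
- by rewrite !vdotE ff zz zf fz; apply: etrans bs; ring.
- by rewrite !vdotE fg zg; ring.
- move=> t tt; rewrite xE EDl !EZl !ipE -W.
  apply: (@unit_triple_bound _ _ _ _ r q a M b s) => //.
  + by rewrite E_isom. + by rewrite E_isom. + by rewrite E_isom // G_isom.
  + exact: E_orth. + exact: EG_E_orth. + by rewrite mulrC.
- move=> u uu Eu Gu; rewrite -W Gu !(E_expectation _ uu Eu) xE !vdotE.
  rewrite ff zz zf fz; transitivity ((r + a) * b + q * s); first by ring.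
  by rewrite raE qE -[RHS]mulr1 -bs; ring.
Qed.

Lemma eq_attains_max (F F' : V -> R) : F =1 F' -> attains_max F -> attains_max F'.
Proof.
move=> FF' [x [y [u [xx yy uu Eu Fu]]]]; exists x, y, u; split=> // t tt.
by rewrite -!FF' Fu.
Qed.

(** * Coordinate expansions of the expectations *)

Lemma ip_E v u : ip (E v u) u = \sum_i v 0 i * ip (e i (ez u)) u.
Proof. by rewrite ip_suml; apply: eq_bigr => i _; rewrite ipZl. Qed.

Lemma ip_G v u : ip (G v u) u = \sum_i v 0 i * ip (I (e i u)) u.
Proof. by rewrite /G linear_sum ip_suml; apply: eq_bigr => i _; rewrite linearZ /= ipZl. Qed.

Lemma ip_EG f g u :
  ip (E f (G g u)) u = \sum_i \sum_j f 0 i * g 0 j * ip (e i (ez (I (e j u)))) u.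
Proof.
rewrite ip_suml; apply: eq_bigr => i _; rewrite ipZl /G /ev !linear_sum /= ip_suml mulr_sumr.
by apply: eq_bigr => j _; rewrite !linearZ /= ipZl mulrA.
Qed.

(** Taking adjoints reverses the order of [e_j e_i], while the product of [I] and [ez] is skew and
    commutes with [e_j e_i]. *)
Lemma two_form_antisym i j u :
  ip (e i (ez (I (e j u)))) u = - ip (e j (ez (I (e i u)))) u.
Proof.
have H k l : e k (ez (I (e l u))) = - e k (e l (I (ez u))).
  by rewrite I_e ez_e -I_ez linearN.
have H' : e j (e i (I (ez u))) = I (ez (e j (e i u))).
  by rewrite !ez_e !linearN /= opprK !I_e.
by rewrite !H !ipNl opprK H' I_skew ez_sym -I_ez e_skew (e_skew j) opprK ipC.
Qed.

End CliffordModule.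

(** * The Jordan-Wigner generators on Fock space *)

Section FockSpace.
Local Open Scope complex_scope.
Variables (R : rcfType) (n : nat).
Local Notation C := (R[i]).
Local Notation m := (n./2).
Implicit Types (s : bits m) (j k : nat).

Lemma flipK j : involutive (@flip m j).
Proof. by move=> s; apply/ffunP => k; rewrite !ffunE; case: eqP => // _; rewrite negbK. Qed.

Lemma flip_comm j k s : flip j (flip k s) = flip k (flip j s).
Proof. by apply/ffunP => l; rewrite !ffunE; case: eqP => //; case: eqP. Qed.

Lemma flip_ge j s : (m <= j)%N -> flip j s = s.
Proof.
by move=> mj; apply/ffunP => k; rewrite ffunE ltn_eqF // (leq_trans (ltn_ord k)).
Qed.

(** As a product over bits, the sign changes in a single factor when one bit is flipped. *)
Lemma sgn_par j s : sgn R (par j s) = \prod_(k : 'I_m | (k < j)%N) (-1) ^+ s k.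
Proof.
rewrite prodrXr /sgn /par -sum1_card; congr (_ ^+ _).
by rewrite big_mkcondr; apply: eq_bigr => k _; case: (s k).
Qed.

Lemma par_flip_lt j k s : (j < k)%N -> (j < m)%N ->
  sgn R (par k (flip j s)) = - sgn R (par k s).
Proof.
move=> jk jm; rewrite !sgn_par (bigD1 (Ordinal jm)) //= [X in _ = - X](bigD1 (Ordinal jm)) //=.
rewrite ffunE eqxx.
rewrite signrN mulNr; congr (- (_ * _)); apply: eq_bigr => l /andP[_ lj].
by rewrite ffunE; case: eqP => // lE; case/eqP: lj; apply: val_inj.
Qed.

Lemma par_flip_ge j k s : (k <= j)%N -> par k (flip j s) = par k s.
Proof.
move=> kj; apply: eq_card => l; rewrite !inE ffunE.
by case: (ltnP l k) => //= lk; rewrite ltn_eqF // (leq_trans lk).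
Qed.

Lemma bitj_flip j k s : (k < m)%N ->
  bitj k (flip j s) = if j == k then ~~ bitj k s else bitj k s.
Proof.
move=> km; have bitE t : bitj k t = t (Ordinal km).
  apply/existsP/idP => [[l /andP[/eqP lk]]|tk].
    by rewrite (_ : l = Ordinal km) //; apply: val_inj.
  by exists (Ordinal km); rewrite eqxx.
by rewrite !bitE ffunE /= eq_sym.
Qed.

(** Each generator flips one bit and multiplies by this phase, so the Clifford relations reduce to
    the behaviour of phases under flips. *)
Definition gam_coef k s : C :=
  'i * sgn R (par k./2 s) * (if odd k then (if bitj k./2 s then 'i else - 'i) else 1).

(* The last generator of an odd-dimensional space has index 2m: the even-index
   formula then covers it, as flip m is the identity. *)
Lemma gamE k (psi : spinor R m) s : (k < n)%N ->
  gam k psi s = gam_coef k s * psi (flip k./2 s).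
Proof.
move=> kn; rewrite /gam /gam_coef; case: ltnP => km.
  by case: (odd k) => //=; rewrite mulr1.
have kE : k = m.*2 by have := odd_double_half n; lia.
by rewrite kE odd_double doubleK flip_ge // mulr1.
Qed.

Lemma sgn_sqr b : sgn R b * sgn R b = 1.
Proof. by rewrite -expr2 sqrr_sign. Qed.

Lemma odd_half_lt k : (k < n)%N -> odd k -> (k./2 < m)%N.
Proof. by have := odd_double_half n; have := odd_double_half k; lia. Qed.

(** The sign string counts only bits strictly below [k./2]; for odd [k] the flip exchanges [i] and
    [-i] in the last factor. *)
Lemma gam_coef_flip k s : (k < n)%N ->
  gam_coef k (flip k./2 s) = (-1) ^+ odd k * gam_coef k s.
Proof.
move=> kn; rewrite /gam_coef par_flip_ge //; case: ifP => ok; last by rewrite mul1r.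
rewrite bitj_flip ?odd_half_lt // eqxx expr1 mulN1r -mulrN.
by case: (bitj _ _); rewrite ?opprK.
Qed.

Lemma gam_coef_flip_lt j k s : (j./2 < k./2)%N -> (k < n)%N ->
  gam_coef k (flip j./2 s) = - gam_coef k s.
Proof.
move=> jk kn; rewrite /gam_coef par_flip_lt //; last first.
  by have := odd_double_half n; have := odd_double_half k; lia.
rewrite mulrN mulNr; case: ifP => // ok.
by rewrite bitj_flip ?odd_half_lt // ltn_eqF.
Qed.

Lemma gam_coef_flip_gt j k s : (k./2 < j./2)%N -> (k < n)%N ->
  gam_coef k (flip j./2 s) = gam_coef k s.
Proof.
move=> kj kn; rewrite /gam_coef par_flip_ge 1?ltnW //; case: ifP => // ok.
by rewrite bitj_flip ?odd_half_lt // gtn_eqF.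
Qed.

Lemma mulii : 'i * 'i = -1 :> C.
Proof. by rewrite -expr2 sqr_i. Qed.

Lemma conjcM (x y : C) : conjc (x * y) = conjc x * conjc y.
Proof. exact: rmorphM. Qed.

(** The phase is imaginary for even [k] and real for odd [k]. *)
Lemma conj_gam_coef k s : conjc (gam_coef k s) = - ((-1) ^+ odd k * gam_coef k s).
Proof.
have cN (x : C) : conjc (- x) = - conjc x by exact: rmorphN.
have c1 : conjc (1 : C) = 1 by exact: rmorph1.
have cs b : conjc (sgn R b) = sgn R b by exact: rmorph_sign.
have ci : conjc ('i : C) = - 'i by simpc.
rewrite /gam_coef !conjcM cs ci; case: (odd k); last by rewrite c1 mul1r !mulNr.
rewrite mulN1r opprK; case: (bitj _ _); rewrite ?cN ci ?opprK ?(mulNr, mulrN) ?opprK //.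
Qed.

Lemma gam_coef_sqr k s : gam_coef k s * gam_coef k s = - (-1) ^+ odd k.
Proof.
rewrite /gam_coef mulrACA (mulrACA 'i) sgn_sqr mulii mulr1.
by case: (odd k); rewrite ?mulr1 //; case: (bitj _ _); rewrite ?mulrNN mulii mulrN1 expr1 ?opprK.
Qed.

Lemma gam_sqr k (psi : spinor R m) s : (k < n)%N -> gam k (gam k psi) s = - psi s.
Proof.
move=> kn; rewrite !gamE // flipK gam_coef_flip // mulrA mulrCA gam_coef_sqr.
by rewrite mulrN -expr2 sqrr_sign mulN1r.
Qed.

Lemma gam_anticomm j k (psi : spinor R m) s : (j < n)%N -> (k < n)%N -> j != k ->
  gam j (gam k psi) s = - gam k (gam j psi) s.
Proof.
(* By symmetry [j] acts on the lower bit, or on the same bit as [k] with [j] even. In both cases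
   exactly one of the two phases changes sign when the other generator flips its bit. *)
wlog jk : j k / (j./2 < k./2)%N || (j./2 == k./2) && ~~ odd j => [WL jn kn jk|].
  have [lt|gt|E] := ltngtP j./2 k./2.
  - by apply: WL; rewrite ?lt.
  - by rewrite (WL k j) ?opprK ?gt 1?eq_sym.
  - have [oj|oj] := boolP (odd j); last by apply: WL; rewrite ?E ?eqxx ?oj ?orbT.
    rewrite (WL k j) ?opprK 1?eq_sym //.
    have := odd_double_half j; have := odd_double_half k; lia.
move=> jn kn jNk; rewrite !gamE // flip_comm.
rewrite [LHS]mulrA [X in _ = - X]mulrA -mulNr; congr (_ * _).
case/orP: jk => [jk|/andP[/eqP jk oj]].
  by rewrite (gam_coef_flip_lt _ jk) // (gam_coef_flip_gt _ jk) // mulrN mulrC.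
have ok : odd k by have := odd_double_half j; have := odd_double_half k; lia.
have := gam_coef_flip s jn; have := gam_coef_flip s kn; rewrite -{1}jk => ->; rewrite jk => ->.
by rewrite (negPf oj) ok expr0 expr1 mul1r mulN1r mulrN mulrC.
Qed.

(** After reindexing by the flip, the parity signs from the flip and from conjugation cancel and
    leave [-1]. *)
Lemma sdot_gam k (phi psi : spinor R m) : (k < n)%N ->
  sdot (gam k phi) psi = - sdot phi (gam k psi).
Proof.
move=> kn; rewrite /sdot (reindex_inj (can_inj (flipK k./2))) -sumrN.
apply: eq_bigr => s _; rewrite !gamE // flipK gam_coef_flip // conjcM conj_gam_coef.
by rewrite mulNr mulrN opprK [RHS]mulrCA mulrA.
Qed.

(* sbar consists of plain functions; V is its copy carrying a real vector space structure. *)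
Local Notation sp := {ffun bits m -> Rcomplex R}.
Local Notation V := (sp * sp)%type.

(** * The spinor space as a real Euclidean space *)

Definition sbar_of (u : V) : sbar R n := (u.1 : spinor R m, u.2 : spinor R m).

Definition to_V (v : sbar R n) : V := ([ffun s => v.1 s], [ffun s => v.2 s]).

Lemma to_VK v : sbar_of (to_V v) = v.
Proof.
case: v => v1 v2; congr (_, _); apply: functional_extensionality => s;
  by rewrite /= ffunE.
Qed.

Definition rdot (u w : V) : R := complex.Re (bdot (sbar_of u) (sbar_of w)).

Lemma RcomplexZ a (x : Rcomplex R) : a *: x = a%:C * x :> R[i].
Proof. by case: x => x y; simpc. Qed.

Lemma Re_sum (I : finType) (F : I -> C) :
  complex.Re (\sum_i F i) = \sum_i complex.Re (F i).
Proof. by apply: (big_morph (@complex.Re R)) => // -[a b] [c d]. Qed.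

Lemma rdotE u w : rdot u w =
  \sum_s (complex.Re (u.1 s * conjc (w.1 s)) + complex.Re (u.2 s * conjc (w.2 s))).
Proof.
rewrite /rdot /bdot /sdot big_split -!Re_sum /=.
by case: (\sum_i _) => a b; case: (\sum_i _).
Qed.

Lemma rdotC u w : rdot u w = rdot w u.
Proof.
have ReC (x y : C) : complex.Re (x * conjc y) = complex.Re (y * conjc x).
  by case: x => a b; case: y => c d; simpc => /=; ring.
by rewrite !rdotE; apply: eq_bigr => s _; rewrite ReC (ReC (u.2 s)).
Qed.

Lemma rdotDl u v w : rdot (u + v) w = rdot u w + rdot v w.
Proof.
have ReD (x y z : C) : complex.Re ((x + y) * z) = complex.Re (x * z) + complex.Re (y * z).
  by case: x => a b; case: y => c d; case: z => f g; simpc => /=; ring.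
rewrite !rdotE -big_split; apply: eq_bigr => s _ /=.
by rewrite !ffunE !ReD addrACA.
Qed.

Lemma rdotZl a u w : rdot (a *: u) w = a * rdot u w.
Proof.
have ReZ (x z : C) : complex.Re (a%:C * x * z) = a * complex.Re (x * z).
  by case: x => b c; case: z => f g; simpc => /=; ring.
rewrite !rdotE mulr_sumr; apply: eq_bigr => s _ /=.
by rewrite !ffunE !RcomplexZ !ReZ mulrDr.
Qed.

Lemma ReJ_ge0 (x : C) : 0 <= complex.Re (x * conjc x).
Proof. by case: x => a b; simpc => /=; rewrite addr_ge0 // -expr2 sqr_ge0. Qed.

Lemma ReJ_eq0 (x : C) : complex.Re (x * conjc x) = 0 -> x = 0.
Proof.
case: x => a b; simpc => /= /eqP; rewrite paddr_eq0 -?expr2 ?sqr_ge0 // !sqrf_eq0.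
by case/andP => /eqP-> /eqP->.
Qed.

Lemma rdot_ge0 u : 0 <= rdot u u.
Proof. by rewrite rdotE sumr_ge0 // => s _; rewrite addr_ge0 ?ReJ_ge0. Qed.

Lemma rdot_eq0 u : rdot u u = 0 -> u = 0.
Proof.
rewrite rdotE => /psumr_eq0P u0.
have {}u0 s : u.1 s = 0 /\ u.2 s = 0.
  have /eqP := u0 (fun s _ => addr_ge0 (ReJ_ge0 _) (ReJ_ge0 _)) s isT.
  by rewrite paddr_eq0 ?ReJ_ge0 // => /andP[/eqP/ReJ_eq0-> /eqP/ReJ_eq0->].
case: u u0 => u1 u2 /= u0; congr (_, _); apply/ffunP => s; rewrite ffunE;
  by case: (u0 s).
Qed.

(** * The Clifford action on this real space *)

Definition Vgen (i : 'I_n) (u : V) : V :=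
  ([ffun s => gam i (u.1 : spinor R m) s], [ffun s => - gam i (u.2 : spinor R m) s]).
Definition Vswap (u : V) : V := (u.2, u.1).
Definition Vi (u : V) : V :=
  ([ffun s => 'i * (u.1 s : C)], [ffun s => 'i * (u.2 s : C)]).

Lemma Vgen_is_linear i : linear (Vgen i).
Proof.
move=> a u w; congr (_, _); apply/ffunP => s; rewrite !ffunE !gamE // !ffunE !RcomplexZ.
  by rewrite mulrDr mulrCA.
by rewrite mulrDr mulrCA opprD mulrN.
Qed.
HB.instance Definition _ i := GRing.isLinear.Build R V V _ (Vgen i) (Vgen_is_linear i).

Lemma Vswap_is_linear : linear Vswap.
Proof. by []. Qed.
HB.instance Definition _ := GRing.isLinear.Build R V V _ Vswap Vswap_is_linear.

Lemma Vi_is_linear : linear Vi.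
Proof.
move=> a u w; congr (_, _); apply/ffunP => s; rewrite !ffunE !RcomplexZ.
  by rewrite mulrDr mulrCA.
by rewrite mulrDr mulrCA.
Qed.
HB.instance Definition _ := GRing.isLinear.Build R V V _ Vi Vi_is_linear.

Lemma sbar_of_Vgen i u : sbar_of (Vgen i u) = ebar i (sbar_of u).
Proof. by congr (_, _); apply: functional_extensionality => s; rewrite /= ffunE. Qed.

Lemma sbar_of_Vi u : sbar_of (Vi u) = iscale (sbar_of u).
Proof. by congr (_, _); apply: functional_extensionality => s; rewrite /= ffunE. Qed.

Lemma sbar_of_Vswap u : sbar_of (Vswap u) = e0 (sbar_of u).
Proof. by []. Qed.

Lemma Vgen_Vgen (i k : 'I_n) u : Vgen i (Vgen k u) =
  ([ffun s => gam i (gam k (u.1 : spinor R m)) s],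
   [ffun s => gam i (gam k (u.2 : spinor R m)) s]).
Proof.
by congr (_, _); apply/ffunP => s; rewrite !ffunE !gamE // !ffunE !gamE // mulrN opprK.
Qed.

Lemma Vgen_cliff (i k : 'I_n) u :
  Vgen i (Vgen k u) + Vgen k (Vgen i u) = (- 2 * (i == k)%:R) *: u.
Proof.
have double (x : R[i]) : - x + - x = (- 2 * 1)%:C * x.
  by case: x => a b; simpc; congr Complex; ring.
rewrite !Vgen_Vgen; have [->|ik] := eqVneq i k.
  by apply/pair_equal_spec; split; apply/ffunP => s; rewrite !ffunE RcomplexZ !gam_sqr ?double.
rewrite mulr0 scale0r.
apply/pair_equal_spec; split; apply/ffunP => s; rewrite !ffunE.
  by rewrite (gam_anticomm _ _ (ltn_ord i) (ltn_ord k) ik) addNr.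
by rewrite (gam_anticomm _ _ (ltn_ord i) (ltn_ord k) ik) addNr.
Qed.

Lemma sdotN (phi psi : spinor R m) : sdot (fun s => - phi s) psi = - sdot phi psi.
Proof. by rewrite -sumrN; apply: eq_bigr => s _; rewrite mulNr. Qed.

Lemma sdotrN (phi psi : spinor R m) : sdot phi (fun s => - psi s) = - sdot phi psi.
Proof.
by rewrite -sumrN; apply: eq_bigr => s _; rewrite -mulrN; congr (_ * _); exact: rmorphN.
Qed.

Lemma Vgen_skew i u w : rdot (Vgen i u) w = - rdot u (Vgen i w).
Proof.
rewrite /rdot !sbar_of_Vgen /bdot /= sdotN sdotrN !sdot_gam // opprK.
by case: (sdot _ _) => a b; case: (sdot _ _) => c d; simpc => /=; ring.
Qed.

Lemma VswapK u : Vswap (Vswap u) = u.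
Proof. by case: u. Qed.

Lemma Vswap_Vgen i u : Vswap (Vgen i u) = - Vgen i (Vswap u).
Proof. by apply/pair_equal_spec; split; apply/ffunP => s; rewrite !ffunE ?opprK. Qed.

Lemma Vswap_sym u w : rdot (Vswap u) w = rdot u (Vswap w).
Proof. by rewrite !rdotE; apply: eq_bigr => s _; rewrite addrC. Qed.

Lemma Vi_Vi u : Vi (Vi u) = - u.
Proof.
by apply/pair_equal_spec; split; apply/ffunP => s; rewrite !ffunE mulrA mulii mulN1r.
Qed.

Lemma Vi_Vgen i u : Vi (Vgen i u) = Vgen i (Vi u).
Proof.
by apply/pair_equal_spec; split; apply/ffunP => s;
  rewrite !ffunE !gamE // ffunE ?mulrN mulrCA.
Qed.

Lemma Vi_Vswap u : Vi (Vswap u) = Vswap (Vi u).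
Proof. by []. Qed.

Lemma Vi_skew u w : rdot (Vi u) w = - rdot u (Vi w).
Proof.
have H (x y : C) : complex.Re ('i * x * conjc y) = - complex.Re (x * conjc ('i * y)).
  by case: x => a b; case: y => c d; simpc => /=; ring.
by rewrite !rdotE -sumrN; apply: eq_bigr => s _; rewrite !ffunE !H opprD.
Qed.

(** * The components of [X], [Y] and [omega] as real expectations *)

Lemma Xsp_sbar_of u i : Xsp (sbar_of u) 0 i = rdot (Vgen i (Vswap u)) u.
Proof. by rewrite mxE /rdot sbar_of_Vgen. Qed.

Lemma Ysp_sbar_of u i : Ysp (sbar_of u) 0 i = rdot (Vi (Vgen i u)) u.
Proof. by rewrite mxE /rdot sbar_of_Vi sbar_of_Vgen. Qed.

(** [Re (i z) = - Im z]; this makes the imaginary part in [omega] a real expectation. *)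
Lemma rdot_Vi u w : rdot (Vi u) w = - complex.Im (bdot (sbar_of u) (sbar_of w)).
Proof.
rewrite /rdot sbar_of_Vi /bdot /= -ReiNIm mulrDl.
rewrite /sdot !mulr_suml; congr (complex.Re (_ + _)); apply: eq_bigr => s _;
  by rewrite [RHS]mulrC mulrA.
Qed.

(** The sign in [Im z = - Re (i z)] cancels the one from moving [e_0] past [e_l]. *)
Lemma omegasp_sbar_of u (i l : 'I_n) :
  omegasp (sbar_of u) i l = rdot (Vgen i (Vswap (Vi (Vgen l u)))) u.
Proof.
rewrite mxE -sbar_of_Vswap -!sbar_of_Vgen -[LHS]opprK -rdot_Vi.
rewrite -Vi_Vswap Vswap_Vgen [Vi (- _)]linearN [Vgen i (- _)]linearN /= -Vi_Vgen.
by rewrite -scaleN1r rdotZl mulN1r.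
Qed.

Local Notation E := (E (fun i : 'I_n => Vgen i : {linear V -> V}) (Vswap : {linear V -> V})).
Local Notation G := (G (fun i : 'I_n => Vgen i : {linear V -> V}) (Vi : {linear V -> V})).

Lemma vdot_Xsp v u : vdot v (Xsp (sbar_of u)) = rdot (E v u) u.
Proof.
rewrite (ip_E rdotC rdotDl rdotZl); apply: eq_bigr => i _.
by rewrite Xsp_sbar_of.
Qed.

Lemma vdot_Ysp v u : vdot v (Ysp (sbar_of u)) = rdot (G v u) u.
Proof.
rewrite (ip_G rdotC rdotDl rdotZl); apply: eq_bigr => i _.
by rewrite Ysp_sbar_of.
Qed.

Lemma fdot_omegasp a (f g : 'rV[R]_n) u :
  fdot (a *: wedge f g) (omegasp (sbar_of u)) = a * rdot (E f (G g u)) u.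
Proof.
rewrite fdotZl fdot_wedge => [|i k].
  rewrite (ip_EG rdotC rdotDl rdotZl); congr (_ * _).
  by apply: eq_bigr => i _; apply: eq_bigr => k _; rewrite omegasp_sbar_of.
rewrite !omegasp_sbar_of.
exact: (two_form_antisym rdotC rdotZl Vgen_skew Vswap_Vgen Vswap_sym Vi_Vgen Vi_Vswap Vi_skew).
Qed.

Lemma exists_neq0 : exists u : V, u != 0.
Proof.
exists ([ffun => (1 : C)], 0); rewrite xpair_eqE negb_and; apply/orP; left.
apply/eqP => /ffunP/(_ [ffun => false]); rewrite !ffunE => /eqP.
by rewrite oner_eq0.
Qed.

Lemma Ffun_attains_max (Cv Pv : 'rV[R]_n) (A : 'M[R]_n) : (3 <= n)%N ->
  [\/ A = 0, simple_form A /\ Cv = 0 | simple_form A /\ Pv = 0] ->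
  attains_max rdot (fun i : 'I_n => Vgen i : {linear V -> V}) Vswap Vi
    (fun u => Ffun Cv Pv A (sbar_of u)).
Proof.
move=> n3 HA; have [u0 u0n] := exists_neq0.
have v0 (w : 'rV[R]_n) : vdot 0 w = 0 by rewrite -(scale0r 0) vdotZl mul0r.
case: HA => [->|[[a [f [g [ff gg fg ->]]]] ->]|[[a [f [g [ff gg fg ->]]]] ->]].
- apply: eq_attains_max (max_energy_EG rdotC rdotDl rdotZl rdot_ge0 rdot_eq0
    Vgen_cliff Vgen_skew VswapK Vswap_Vgen Vswap_sym Vi_Vi Vi_Vgen Vi_Vswap Vi_skew
    Cv Pv n3 u0n) => u.
  by rewrite /Ffun vdot_Xsp vdot_Ysp -(scale0r 0) fdotZl mul0r addr0.
- apply: eq_attains_max (max_energy_GW rdotC rdotDl rdotZl rdot_ge0 rdot_eq0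
    Vgen_cliff Vgen_skew VswapK Vswap_Vgen Vswap_sym Vi_Vi Vi_Vgen Vi_Vswap Vi_skew
    Pv a n3 u0n ff gg fg) => u.
  by rewrite /Ffun v0 add0r vdot_Ysp fdot_omegasp.
- apply: eq_attains_max (max_energy_EW rdotC rdotDl rdotZl rdot_ge0 rdot_eq0
    Vgen_cliff Vgen_skew VswapK Vswap_Vgen Vswap_sym Vi_Vi Vi_Vgen Vi_Vswap Vi_skew
    Cv a n3 u0n ff gg fg) => u.
  by rewrite /Ffun v0 addr0 vdot_Xsp fdot_omegasp.
Qed.

Lemma NspE u : Nsp (sbar_of u) = rdot u u.
Proof. by []. Qed.

(** [<v, X(u)> = <v, x>] for every [v]; taking [v = X(u)] and then [v = x] gives [|X(u)|^2 = |x|^2],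
    and likewise for [Y]. *)
Lemma vnorm_XY u x y : rdot u u = 1 -> vdot x x = 1 -> vdot y y = 1 ->
  E x u = u -> G y u = u ->
  vnorm (Xsp (sbar_of u)) = 1 /\ vnorm (Ysp (sbar_of u)) = 1.
Proof.
move=> uu xx yy Eu Gu.
have EX v : vdot v (Xsp (sbar_of u)) = vdot v x.
  rewrite vdot_Xsp.
  exact: (E_expectation rdotC rdotDl rdotZl Vgen_cliff Vgen_skew VswapK Vswap_Vgen Vswap_sym).
have GY v : vdot v (Ysp (sbar_of u)) = vdot v y.
  rewrite vdot_Ysp.
  exact: (G_expectation rdotC rdotDl rdotZl Vgen_cliff Vgen_skew Vi_Vi Vi_Vgen Vi_skew).
split; first by rewrite /vnorm EX vdotC EX xx sqrtr1.
by rewrite /vnorm GY vdotC GY yy sqrtr1.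
Qed.

End FockSpace.

(** * From the maximum to the minimum *)

Theorem mainTheorem12 (R : rcfType) (n : nat) (Cv Pv : 'rV[R]_n) (A : 'M[R]_n) :
  (3 <= n)%N ->
  two_form A ->
  [\/ A = 0,
      simple_form A /\ Cv = 0
    | simple_form A /\ Pv = 0] ->
  exists u : sbar R n,
    [/\ Num.sqrt (Nsp u) = 1,
        (forall v : sbar R n, Num.sqrt (Nsp v) = 1 -> Ffun Cv Pv A u <= Ffun Cv Pv A v),
        Nsp u = 1, vnorm (Xsp u) = 1 & vnorm (Ysp u) = 1].
Proof.
move=> n3 _ HA.
(* Each of the three cases is stable under changing the signs of all coefficients, which replaces
   [F] by [- F]. *)
have HA' : [\/ - A = 0, simple_form (- A) /\ - Cv = 0 | simple_form (- A) /\ - Pv = 0].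
  have simpleN : simple_form A -> simple_form (- A).
    by move=> [a [f [g [ff gg fg ->]]]]; exists (- a), f, g; rewrite scaleNr.
  by case: HA => [->|[/simpleN HA ->]|[/simpleN HA ->]]; rewrite oppr0;
    [apply: Or31|apply: Or32|apply: Or33].
have FN u : Ffun (- Cv) (- Pv) (- A) u = - Ffun Cv Pv A u.
  by rewrite /Ffun !vdotNl -scaleN1r fdotZl mulN1r !opprD.
have [x [y [u [xx yy uu [Eu Gu] Fmax]]]] := Ffun_attains_max n3 HA'.
have [X1 Y1] := vnorm_XY uu xx yy Eu Gu.
exists (sbar_of u); split; rewrite ?NspE ?uu ?sqrtr1 // => v.
rewrite -[v]to_VK NspE => vv.
by rewrite -lerN2 -!FN Fmax // -[LHS]sqr_sqrtr ?rdot_ge0 // vv expr1n.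
Qed.
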